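(* For every set $F$, the class $\mathcal{LO}_{Fa}$ of linearly ordered sets equipped with an $F$-indexed family of order automorphisms has the strong amalgamation property.
   Context: An order automorphism of a linearly ordered set is a bijection $f$ with $a\le b\iff f(a)\le f(b)$. Structures in $\mathcal{LO}_{Fa}$ are $(L,\le,(f)_{f\in F})$ with each $f$ an order automorphism of $(L,\le)$. Embeddings are injective maps commuting with all operations and satisfying $c\le d\iff \iota(c)\le\iota(d)$. A class $\mathcal K$ closed under isomorphism has the strong amalgamation property (SAP) if whenever $\mathbf A,\mathbf B,\mathbf C\in\mathcal K$ and $\iota_1:\mathbf C\to\mathbf A$, $\iota_2:\mathbf C\to\mathbf B$ are embeddings, there exist $\mathbf D\in\mathcal K$ and embeddings $j_1:\mathbf A\to\mathbf D$, $j_2:\mathbf B\to\mathbf D$ with $j_1\circ\iota_1=j_2\circ\iota_2$ and $j_1(A)\cap j_2(B)=j_1(\iota_1(C))$. *)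

(* Defs.v *)
From Corelib Require Import ssreflect ssrfun.
From Stdlib Require Import Relation_Definitions Setoid.

(* Structures in the signature with one binary relation symbol and one unary
   operation symbol for each element of F.  The carrier may be empty. *)
Record structure (F : Type) : Type := Structure {
  carrier :> Type;
  leq : relation carrier;
  op : F -> carrier -> carrier
}.
Arguments leq {F} s _ _.
Arguments op {F} s _ _.

(* [order] is the Stdlib notion of a (non-strict) partial order. *)
Definition linear_order {L : Type} (R : relation L) : Prop :=
  order L R /\ (forall a b : L, R a b \/ R b a).

Definition order_automorphism {L : Type} (R : relation L) (f : L -> L) : Prop :=
  bijective f /\ (forall a b : L, R a b <-> R (f a) (f b)).

Definition LO_Fa (F : Type) (A : structure F) : Prop :=
  linear_order (leq A) /\ (forall f : F, order_automorphism (leq A) (op A f)).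

Definition embedding {F : Type} {A B : structure F} (i : A -> B) : Prop :=
  injective i /\
  (forall (f : F) (c : A), i (op A f c) = op B f (i c)) /\
  (forall c d : A, leq A c d <-> leq B (i c) (i d)).

Definition isomorphism {F : Type} {A B : structure F} (i : A -> B) : Prop :=
  embedding i /\ bijective i.

Definition iso_closed {F : Type} (K : structure F -> Prop) : Prop :=
  forall (A B : structure F) (i : A -> B), isomorphism i -> K A -> K B.

Definition image {X Y : Type} (f : X -> Y) (y : Y) : Prop := exists x : X, f x = y.

Definition strong_amalgamation {F : Type} (K : structure F -> Prop) : Prop :=
  forall A B C : structure F, K A -> K B -> K C ->
  forall (i1 : C -> A) (i2 : C -> B), embedding i1 -> embedding i2 ->
  exists (D : structure F) (j1 : A -> D) (j2 : B -> D),
    K D /\ embedding j1 /\ embedding j2 /\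
    (forall c : C, j1 (i1 c) = j2 (i2 c)) /\
    (forall d : D, image j1 d /\ image j2 d <-> image (fun c => j1 (i1 c)) d).

Lemma LO_Fa_iso_closed (F : Type) : iso_closed (LO_Fa F).
Proof.
move=> A B i [[_ [opi lei]] [g gi ig]] [[[rA tA aA] totA] autA].
have leg x y : leq B x y <-> leq A (g x) (g y) by rewrite lei !ig.
have opg f x : op B f x = i (op A f (g x)) by rewrite opi ig.
split; [split; [split|]|move=> f; split].
- by move=> x; apply/leg.
- by move=> x y z /leg xy /leg yz; apply/leg; apply: tA xy yz.
- move=> x y /leg xy /leg yx; rewrite -(ig x) -(ig y).
  by congr (i _); apply: aA.
- by move=> x y; rewrite !leg; apply: totA.
- have [[h hK Kh] _] := autA f.
  exists (fun x => i (h (g x))) => x; first by rewrite opg gi hK ig.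
  by rewrite opg gi Kh ig.
- move=> x y; rewrite !leg !opg !gi.
  by have [_ ->] := autA f.
Qed.

(* Main.v *)
Require Import Defs.
From Corelib Require Import ssreflect ssrfun.
From Stdlib Require Import Classical ClassicalEpsilon.
From Stdlib Require Import FunctionalExtensionality PropExtensionality.

(** The disjoint union of [A] and [B] carries a total preorder which extends
    both orders and identifies precisely the two copies of [C]: put [b] below
    [a] when some element of [C] lies between them, and [a] below [b] when the
    cut of [a] in [C] is contained in that of [b]; thus a point of [A] precedes
    a point of [B] filling the same cut of [C].  Every [f] restricts to a
    bijection of [C], so it preserves this preorder, and the quotient of the
    preorder by its equivalence relation is the strong amalgam. *)

Section PreorderQuotient.

Variables (F : Type) (P : structure F).
Hypothesis leqxx : forall x : P, leq P x x.
Hypothesis leq_trans :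
  forall x y z : P, leq P x y -> leq P y z -> leq P x z.
Hypothesis leq_total : forall x y : P, leq P x y \/ leq P y x.
Hypothesis op_auto : forall f : F, order_automorphism (leq P) (op P f).

Definition leq_equiv (x y : P) : Prop := leq P x y /\ leq P y x.

Definition repr (x : P) : P := epsilon (inhabits x) (leq_equiv x).

Lemma repr_equiv (x : P) : leq_equiv x (repr x).
Proof. by apply: epsilon_spec; exists x; split; apply: leqxx. Qed.

(** By transitivity equivalent points have extensionally equal predicates [leq_equiv x] and
    [leq_equiv y], so [epsilon] makes the same choice for both. *)
Lemma eq_repr (x y : P) : leq_equiv x y -> repr x = repr y.
Proof.
move=> [xy yx]; rewrite /repr (proof_irrelevance _ (inhabits x) (inhabits y)).
congr epsilon; apply: functional_extensionality => z.
apply: propositional_extensionality.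
by split=> -[l1 l2]; split; apply: leq_trans; eassumption.
Qed.

(** Each class is represented by its unique point fixed by [repr], so the quotient order is a mere
    restriction of [leq P]. *)
Definition quot : Type := {x : P | repr x = x}.

Lemma repr_idem (x : P) : repr (repr x) = repr x.
Proof. by apply/esym/eq_repr/repr_equiv. Qed.

Definition quot_pi (x : P) : quot := exist _ (repr x) (repr_idem x).

Lemma quot_val_inj (d e : quot) : proj1_sig d = proj1_sig e -> d = e.
Proof.
by case: d e => [x hx] [y hy] /= xy; subst y; rewrite (proof_irrelevance _ hx hy).
Qed.

Lemma quot_piK (d : quot) : quot_pi (proj1_sig d) = d.
Proof. by apply: quot_val_inj; case: d. Qed.

Lemma quot_pi_eq (x y : P) : leq_equiv x y -> quot_pi x = quot_pi y.
Proof. by move=> /eq_repr xy; apply: quot_val_inj. Qed.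

Definition quot_structure : structure F :=
  Structure F quot (fun d e => leq P (proj1_sig d) (proj1_sig e))
    (fun f d => quot_pi (op P f (proj1_sig d))).

Lemma leq_quot_pi (x y : P) :
  leq quot_structure (quot_pi x) (quot_pi y) <-> leq P x y.
Proof.
have [xr rx] := repr_equiv x; have [yr ry] := repr_equiv y.
by split=> /= xy; [apply: leq_trans xr (leq_trans _ _ _ xy ry)
                 | apply: leq_trans rx (leq_trans _ _ _ xy yr)].
Qed.

Lemma eq_quot_pi (x y : P) : quot_pi x = quot_pi y <-> leq_equiv x y.
Proof.
split; last exact: quot_pi_eq.
by move=> xy; split; apply/leq_quot_pi; rewrite xy; apply: leqxx.
Qed.

Lemma op_quot_pi (f : F) (x : P) :
  op quot_structure f (quot_pi x) = quot_pi (op P f x).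
Proof.
have [_ mono] := op_auto f; have [xr rx] := repr_equiv x.
by apply: quot_pi_eq; split; apply: (proj1 (mono _ _)).
Qed.

Lemma quot_LO_Fa : LO_Fa F quot_structure.
Proof.
split; first (split; first split).
- by move=> d; apply: leqxx.
- by move=> d e g; apply: leq_trans.
- move=> d e de ed; rewrite -(quot_piK d) -(quot_piK e).
  exact: quot_pi_eq.
- by move=> d e; apply: leq_total.
- move=> f; have [[g fK gK] mono] := op_auto f; split; last first.
    move=> d e; rewrite -(quot_piK d) -(quot_piK e) !op_quot_pi !leq_quot_pi.
    exact: mono.
  (* Since [f] reflects the preorder, its inverse [g] preserves equivalence and induces the inverse
     on the quotient. *)
  have g_equiv x y : leq_equiv x y -> leq_equiv (g x) (g y).
    by move=> [xy yx]; split; apply: (proj2 (mono _ _)); rewrite !gK.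
  exists (fun d => quot_pi (g (proj1_sig d))) => d.
    (* The quotient operation normalizes by [repr] before [g] is applied, so [g] cancels [f] only up
       to equivalence. *)
    rewrite -[RHS]quot_piK -[X in _ = quot_pi X]fK.
    apply: quot_pi_eq; apply: g_equiv.
    by have [] := repr_equiv (op P f (proj1_sig d)).
  by rewrite op_quot_pi gK quot_piK.
Qed.

End PreorderQuotient.

Section Amalgam.

Variables (F : Type) (A B C : structure F) (i1 : C -> A) (i2 : C -> B).

Definition amalgam_leq (x y : A + B) : Prop :=
  match x, y with
  | inl a, inl a' => leq A a a'
  | inr b, inr b' => leq B b b'
  | inr b, inl a => exists c, leq B b (i2 c) /\ leq A (i1 c) a
  | inl a, inr b => (forall c, leq A (i1 c) a -> leq B (i2 c) b) /\
                    (forall c, leq B b (i2 c) -> leq A a (i1 c))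
  end.

Definition amalgam_op (f : F) (x : A + B) : A + B :=
  match x with inl a => inl (op A f a) | inr b => inr (op B f b) end.

Definition amalgam : structure F := Structure F (A + B) amalgam_leq amalgam_op.

Hypotheses (LO_A : LO_Fa F A) (LO_B : LO_Fa F B) (LO_C : LO_Fa F C).
Hypotheses (emb1 : embedding i1) (emb2 : embedding i2).

Lemma amalgam_leqxx (x : amalgam) : leq amalgam x x.
Proof.
have [[[rA _ _] _] _] := LO_A; have [[[rB _ _] _] _] := LO_B.
by case: x => [a|b]; [apply: rA | apply: rB].
Qed.

(** When the chain crosses between [A] and [B] twice, one crossing supplies a [c] in [C] and the cut
    condition of the other moves the remaining endpoint past [c]. *)
Lemma amalgam_leq_trans (x y z : amalgam) :
  leq amalgam x y -> leq amalgam y z -> leq amalgam x z.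
Proof.
have [[[_ tA _] _] _] := LO_A; have [[[_ tB _] _] _] := LO_B.
case: x y z => [a|b] [a'|b'] [a''|b''] /=.
- exact: tA.
- move=> aa' [lo hi]; split=> c; first by move=> ca; apply: lo; apply: tA ca aa'.
  by move=> /hi; apply: tA.
- by move=> [_ hi] [c [/hi ac ca]]; apply: tA ac ca.
- move=> [lo hi] bb'; split=> c; first by move=> /lo cb; apply: tB cb bb'.
  by move=> bc; apply: hi; apply: tB bb' bc.
- by move=> [c [bc ca]] aa'; exists c; split=> //; apply: tA ca aa'.
- by move=> [c [bc ca]] [lo _]; apply: tB bc (lo _ ca).
- by move=> bb' [c [bc ca]]; exists c; split=> //; apply: tB bb' bc.
- exact: tB.
Qed.

(** If no [c] satisfies [b <= c <= a], then by totality every [c] below [a] lies below [b], and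
    every [c] above [b] lies above [a]. *)
Lemma amalgam_leq_inl_inr_total (a : A) (b : B) :
  leq amalgam (inl a) (inr b) \/ leq amalgam (inr b) (inl a).
Proof.
have [[_ totA] _] := LO_A; have [[_ totB] _] := LO_B.
case: (classic (leq amalgam (inr b) (inl a))) => [|nba]; first by right.
left; split=> c cP.
  by case: (totB (i2 c) b) => // bc; case: nba; exists c.
by case: (totA a (i1 c)) => // ca; case: nba; exists c.
Qed.

Lemma amalgam_leq_total (x y : amalgam) : leq amalgam x y \/ leq amalgam y x.
Proof.
have [[_ totA] _] := LO_A; have [[_ totB] _] := LO_B.
case: x y => [a|b] [a'|b']; [exact: totA | | | exact: totB].
  exact: amalgam_leq_inl_inr_total.
by case: (amalgam_leq_inl_inr_total a' b); [right | left].
Qed.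

Lemma amalgam_op_auto (f : F) :
  order_automorphism (leq amalgam) (op amalgam f).
Proof.
have [_ /(_ f) [[gA fKA gKA] mA]] := LO_A.
have [_ /(_ f) [[gB fKB gKB] mB]] := LO_B.
have [_ /(_ f) [[gC _ gKC] _]] := LO_C.
have [_ [op1 _]] := emb1; have [_ [op2 _]] := emb2.
split.
  exists (fun x => match x with inl a => inl (gA a) | inr b => inr (gB b) end).
    by case=> [a|b] /=; rewrite ?fKA ?fKB.
  by case=> [a|b] /=; rewrite ?gKA ?gKB.
case=> [a|b] [a'|b'] /=; [exact: mA | | | exact: mB].
- split=> -[lo hi]; split=> c.
  (* As [f] is onto [C], the arbitrary [c] is written as the image of [gC c], and [f] then cancels
     from both inequalities. *)
  + by rewrite -(gKC c) op1 op2 -mA -mB; apply: lo.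
  + by rewrite -(gKC c) op1 op2 -mA -mB; apply: hi.
  + by rewrite mA mB -op1 -op2; apply: lo.
  + by rewrite mA mB -op1 -op2; apply: hi.
- split=> -[c [bc ca]].
    by exists (op C f c); rewrite op1 op2 -mA -mB.
  by exists (gC c); rewrite mA mB -op1 -op2 gKC.
Qed.

(** The [c] with [b <= c <= a], fed to both cut conditions, also gives [a <= c <= b]; antisymmetry
    does the rest. This is what makes the amalgamation strong. *)
Lemma amalgam_equiv_inl_inr (a : A) (b : B) :
  leq_equiv F amalgam (inl a) (inr b) <-> exists c, i1 c = a /\ i2 c = b.
Proof.
have [[[rA _ aA] _] _] := LO_A; have [[[rB _ aB] _] _] := LO_B.
have [_ [_ m1]] := emb1; have [_ [_ m2]] := emb2.
split=> [[[lo hi] [c [bc ca]]]|[c [<- <-]]].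
  by exists c; split; [apply: aA (hi _ bc) | apply: aB (lo _ ca) _].
split; last by exists c; split; [apply: rB | apply: rA].
(* For the two copies of [c], both sides of each cut condition become the same comparison of [c']
   with [c] in [C]. *)
by split=> c'; rewrite -m1 -m2.
Qed.

End Amalgam.

Theorem theorem3p1 (F : Type) : strong_amalgamation (LO_Fa F).
Proof.
move=> A B C LO_A LO_B LO_C i1 i2 emb1 emb2.
pose P := amalgam F A B C i1 i2.
have refl : forall x : P, leq P x x by apply: amalgam_leqxx.
have trans : forall x y z : P, leq P x y -> leq P y z -> leq P x z.
  exact: amalgam_leq_trans.
have auto : forall f, order_automorphism (leq P) (op P f).
  by move=> f; apply: amalgam_op_auto.
have leq_pi := leq_quot_pi F P refl trans.
have eq_pi := eq_quot_pi F P refl trans.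
have op_pi := op_quot_pi F P refl trans auto.
have glue := amalgam_equiv_inl_inr F A B C i1 i2 LO_A LO_B emb1 emb2.
have [[[_ _ aA] _] _] := LO_A; have [[[_ _ aB] _] _] := LO_B.
pose pi (x : P) : quot_structure F P refl trans := quot_pi F P refl trans x.
exists (quot_structure F P refl trans), (fun a => pi (inl a)), (fun b => pi (inr b)).
split; [|split; [|split; [|split]]].
- by apply: quot_LO_Fa => //; apply: amalgam_leq_total.
- split; [|split].
  + by move=> a a' /eq_pi [aa' a'a]; apply: aA.
  + by move=> f a; rewrite op_pi.
  + by move=> a a'; rewrite leq_pi.
- split; [|split].
  + by move=> b b' /eq_pi [bb' b'b]; apply: aB.
  + by move=> f b; rewrite op_pi.
  + by move=> b b'; rewrite leq_pi.
- by move=> c; apply/eq_pi/glue; exists c.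
- move=> d; split=> [[[a <-] [b ba]]|[c <-]].
    (* A common point of the two images is an equivalence between a point of [A] and one of [B], so
       it comes from [C]. *)
    by have /glue [c [<- _]] := proj1 (eq_pi _ _) (esym ba); exists c.
  split; first by exists (i1 c).
  by exists (i2 c); apply/esym/eq_pi/glue; exists c.
Qed.
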